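(* Let $F$ be a field of characteristic zero and let $\mathfrak g$ be a Borcherds Lie algebra over $F$ of rank $l$, with Cartan subalgebra $\mathfrak h$ and Chevalley generators $e_1,\dots,e_l,f_1,\dots,f_l$. Let $\mathfrak g'=[\mathfrak g,\mathfrak g]$, $\mathfrak h'=\mathfrak h\cap\mathfrak g'$, and let $\mathfrak h''$ be a vector space complement of $\mathfrak h'$ in $\mathfrak h$, so $\mathfrak h=\mathfrak h''\oplus\mathfrak h'$. Let $\mathfrak g_+$ (resp. $\mathfrak g_-$) be the subalgebra of $\mathfrak g$ generated by $e_1,\dots,e_l$ (resp. $f_1,\dots,f_l$). Let $\{1,2,\dots,l\}=I\cup J$ be a partition into disjoint subsets $I$ and $J$ (either of which may be empty). Then $$U(\mathfrak g)=\Big(\prod_{i\in I}U(Fe_i)\Big)\,U(\mathfrak g_-)\,U(\mathfrak h'')\,U(\mathfrak g_+)\,\Big(\prod_{j\in J}U(Ff_j)\Big).$$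
   Context: For a Lie algebra $\mathfrak a$ over $F$, $U(\mathfrak a)$ denotes its universal enveloping algebra; for a subalgebra $\mathfrak b\subseteq\mathfrak a$, $U(\mathfrak b)$ is regarded as a subalgebra of $U(\mathfrak a)$. For subspaces $A,B$ of $U(\mathfrak a)$, $AB$ denotes the linear span of all products $ab$ with $a\in A$, $b\in B$; products $\prod_{i\in I}$, $\prod_{j\in J}$ of subspaces are taken in increasing order of the index, and an empty product is $F\cdot 1$. Borcherds Lie algebras (generalized Kac-Moody algebras) of rank $l\ge 1$: let $A=(a_{ij})$ be a real $l\times l$ matrix, with entries in a subfield of $\mathbb R$ embedded in $F$, such that (i) $a_{ii}=2$ or $a_{ii}\le 0$; (ii) $a_{ij}\le 0$ for $i\ne j$, and $a_{ij}\in\mathbb Z$ if $a_{ii}=2$; (iii) $a_{ij}=0$ implies $a_{ji}=0$. Let $\mathfrak h$ be a finite dimensional $F$-vector space with linearly independent elements $h_1,\dots,h_l\in\mathfrak h$ and nonzero functionals $\alpha_1,\dots,\alpha_l\in\mathfrak h^*$ with $\alpha_j(h_i)=a_{ij}$. Let $\tilde{\mathfrak g}$ be the Lie algebra generated by $\mathfrak h$, $e_i,f_i$ ($1\le i\le l$) with relations $[h,\bar h]=0$, $[h,e_i]=\alpha_i(h)e_i$, $[h,f_i]=-\alpha_i(h)f_i$, $[e_i,f_j]=\delta_{ij}h_i$ for $h,\bar h\in\mathfrak h$; it is graded by the free abelian group on $\varepsilon_1,\dots,\varepsilon_l$ via $\deg e_i=\varepsilon_i$, $\deg f_i=-\varepsilon_i$,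 $\deg\mathfrak h=0$. Then $\mathfrak g$ is the quotient of $\tilde{\mathfrak g}$ by its largest graded ideal meeting $\mathfrak h$ trivially. One has $\mathfrak g=\mathfrak g_-\oplus\mathfrak h\oplus\mathfrak g_+$ and $\mathfrak g=\mathfrak h''\oplus\mathfrak g'$. Kac-Moody Lie algebras are the case where all $a_{ii}=2$ and all entries are integers. *)

(* Defs.v *)
From HB Require Import structures.
From mathcomp Require Import all_boot all_order all_algebra.
From mathcomp Require Import boolp classical_sets reals.
Set Implicit Arguments.
Unset Strict Implicit.
Unset Printing Implicit Defensive.
Import Order.TTheory GRing.Theory Num.Theory.
Local Open Scope classical_set_scope.
Local Open Scope ring_scope.

HB.mixin Record isLieAlgebra (F : fieldType) L of GRing.Lmodule F L := {
  bracket : L -> L -> L;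
  bracketPl : forall (a : F) x y z,
    bracket (a *: x + y) z = a *: bracket x z + bracket y z;
  bracketPr : forall (a : F) x y z,
    bracket z (a *: x + y) = a *: bracket z x + bracket z y;
  bracketxx : forall x, bracket x x = 0;
  jacobi : forall x y z,
    bracket x (bracket y z) + bracket y (bracket z x)
      + bracket z (bracket x y) = 0
}.

#[short(type="lieAlgType")]
HB.structure Definition LieAlgebra (F : fieldType) :=
  {L of isLieAlgebra F L & GRing.Lmodule F L}.

Section Subspaces.
Variables (F : fieldType) (V : lmodType F).

Definition is_subspace (A : set V) : Prop :=
  A 0 /\ forall (a : F) x y, A x -> A y -> A (a *: x + y).

Definition lin_span (S : set V) : set V := smallest is_subspace S.

Definition is_complement (C B A : set V) : Prop :=
  [/\ is_subspace C, C `<=` A, C `&` B = [set 0]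
    & A = [set x + y | x in C & y in B]].

End Subspaces.

Section LieAlgebras.
Variable F : fieldType.
Implicit Types L M : lieAlgType F.

Definition is_lie_morphism L M (phi : L -> M) : Prop :=
  forall x y, phi (bracket x y) = bracket (phi x) (phi y).

Definition is_lie_subalgebra L (A : set L) : Prop :=
  is_subspace A /\ forall x y, A x -> A y -> A (bracket x y).

Definition lie_gen L (S : set L) : set L := smallest (@is_lie_subalgebra L) S.

Definition is_lie_ideal L (N : set L) : Prop :=
  is_subspace N /\ forall x y, N y -> N (bracket x y).

Definition derived L : set L :=
  lin_span [set bracket x y | x in [set: L] & y in [set: L]].

End LieAlgebras.

Section Enveloping.
Variable F : fieldType.

Definition is_enveloping_map (L : lieAlgType F) (B : algType F)
    (f : L -> B) : Prop :=
  forall x y, f (bracket x y) = f x * f y - f y * f x.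

Definition is_enveloping_algebra (L : lieAlgType F) (U : algType F)
    (j : {linear L -> U}) : Prop :=
  is_enveloping_map j /\
  forall (B : algType F) (f : {linear L -> B}), is_enveloping_map f ->
    (exists phi : {lrmorphism U -> B}, phi \o j =1 f) /\
    (forall phi psi : {lrmorphism U -> B},
       phi \o j =1 f -> psi \o j =1 f -> phi =1 psi).

Definition is_subalgebra (U : algType F) (A : set U) : Prop :=
  [/\ is_subspace A, A 1 & forall x y, A x -> A y -> A (x * y)].

(* U(b) as a subalgebra of U(L): the image of the canonical map from U(b) to
   U(L), i.e. the unital subalgebra generated by b. *)
Definition env_sub (L : lieAlgType F) (U : algType F) (j : L -> U)
    (b : set L) : set U :=
  smallest (@is_subalgebra U) (j @` b).

Definition set_mul (U : algType F) (A B : set U) : set U :=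
  lin_span [set a * b | a in A & b in B].

Definition set_one (U : algType F) : set U := lin_span [set 1].

End Enveloping.

Section Borcherds.

Definition is_borcherds_matrix (R : realType) (l : nat) (A : 'M[R]_l) : Prop :=
  [/\ forall i, A i i = 2 \/ A i i <= 0,
      forall i j, i != j -> A i j <= 0,
      forall i j, i != j -> A i i = 2 -> A i j \is a Num.int
    & forall i j, A i j = 0 -> A j i = 0].

Variables (F : fieldType) (l : nat) (H : vectType F).
Variables (hc : 'I_l -> H) (alpha : 'I_l -> 'Hom(H, F^o)).

Definition chevalley_relations (L : lieAlgType F) (h : H -> L)
    (e f : 'I_l -> L) : Prop :=
  [/\ forall x y, bracket (h x) (h y) = 0,
      forall x i, bracket (h x) (e i) = (alpha i x : F) *: e i,
      forall x i, bracket (h x) (f i) = - (alpha i x : F) *: f i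
    & forall i k, bracket (e i) (f k) = if i == k then h (hc i) else 0].

(* L is presented by generators H, e_i, f_i (linearly in H) and the relations
   above: it is initial among the Lie algebras where these hold. *)
Definition is_chevalley_presented (L : lieAlgType F) (h : {linear H -> L})
    (e f : 'I_l -> L) : Prop :=
  chevalley_relations h e f /\
  forall (M : lieAlgType F) (hM : {linear H -> M}) (eM fM : 'I_l -> M),
    chevalley_relations hM eM fM ->
    let extends (phi : L -> M) :=
      [/\ is_lie_morphism phi, phi \o h =1 hM, phi \o e =1 eM
        & phi \o f =1 fM] in
    (exists phi : {linear L -> M}, extends phi) /\
    (forall phi psi : {linear L -> M}, extends phi -> extends psi ->
       phi =1 psi).

(* Homogeneous components of the grading by the free abelian group 'rV[int]_l,
   whose basis vectors epsilon_i are delta_mx 0 i. *)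
Inductive homogeneous (L : lieAlgType F) (h : H -> L) (e f : 'I_l -> L) :
    'rV[int]_l -> L -> Prop :=
| homogeneous_h x : homogeneous h e f 0 (h x)
| homogeneous_e i : homogeneous h e f (delta_mx 0 i) (e i)
| homogeneous_f i : homogeneous h e f (- delta_mx 0 i) (f i)
| homogeneous_0 d : homogeneous h e f d 0
| homogeneous_lin d (a : F) x y :
    homogeneous h e f d x -> homogeneous h e f d y ->
    homogeneous h e f d (a *: x + y)
| homogeneous_bracket d d' x y :
    homogeneous h e f d x -> homogeneous h e f d' y ->
    homogeneous h e f (d + d') (bracket x y).

Definition is_graded_ideal (L : lieAlgType F) (h : H -> L)
    (e f : 'I_l -> L) (N : set L) : Prop :=
  is_lie_ideal N /\
  N `<=` lin_span [set x | N x /\ exists d, homogeneous h e f d x].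

Definition is_largest_graded_ideal (L : lieAlgType F) (h : H -> L)
    (e f : 'I_l -> L) (N : set L) : Prop :=
  let good N' := is_graded_ideal h e f N' /\ N' `&` range h = [set 0] in
  good N /\ forall N', good N' -> N' `<=` N.

(* g, with the image of H and the elements e_i, f_i, is the quotient of the
   presented Lie algebra by its largest graded ideal meeting H trivially. *)
Definition is_borcherds_algebra (g : lieAlgType F) (h : {linear H -> g})
    (e f : 'I_l -> g) : Prop :=
  exists (gt : lieAlgType F) (ht : {linear H -> gt}) (et ft : 'I_l -> gt)
         (p : {linear gt -> g}),
  [/\ is_chevalley_presented ht et ft,
      is_lie_morphism p /\ range p = [set: g],
      is_largest_graded_ideal ht et ft [set x | p x = 0]
    & [/\ p \o ht =1 h, p \o et =1 e & p \o ft =1 f]].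

End Borcherds.

(* Main.v *)
(* Write A- and A+ for the subalgebras of U generated by the f_i and the e_i,
   and put T(C) = A- U(C) A+ for C inside h.  Then U = T(h), and h is spanned by
   h'' and the h_i: sending e_i, f_i to 0 maps g~ to the abelian Lie algebra
   h / <h_1, ..., h_l>, and this map kills both derived elements and the graded
   ideal defining g.  It therefore suffices to trade each h_i for an extra factor
   U(F e_i) on the left or U(F f_i) on the right:
     T(C + F h_i) <= U(F e_i) T(C)   and   T(C + F h_i) <= T(C) U(F f_i).
   The first holds because ad e_i acts on A- as x |-> d(x) h_i modulo A-, where d
   is a derivation which removes one letter f_i and is onto in characteristic 0;
   so any x h_i (x in A-) is e_i y - y e_i modulo A-.  The second is the first in
   the converse algebra of U, where the e_i and the f_i exchange roles. *)

Require Import Defs.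
From HB Require Import structures.
From mathcomp Require Import all_boot all_order all_algebra.
From mathcomp Require Import boolp classical_sets reals.
Set Implicit Arguments.
Unset Strict Implicit.
Unset Printing Implicit Defensive.
Import Order.TTheory GRing.Theory Num.Theory.
Local Open Scope classical_set_scope.
Local Open Scope ring_scope.

(** * Linear algebra: subspaces and spans *)

Section Subspaces.
Variables (F : fieldType) (V : lmodType F).
Implicit Types A S : set V.

Lemma subspace0 A : is_subspace A -> A 0. Proof. by case. Qed.

Lemma subspaceD A x y : is_subspace A -> A x -> A y -> A (x + y).
Proof. by case=> _ AP Ax Ay; rewrite -[x]scale1r; apply: AP. Qed.

Lemma subspaceZ A a x : is_subspace A -> A x -> A (a *: x).
Proof. by case=> A0 AP Ax; rewrite -[_ *: _]addr0; apply: AP. Qed.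

Lemma subspaceN A x : is_subspace A -> A x -> A (- x).
Proof. by move=> sA Ax; rewrite -scaleN1r; apply: subspaceZ. Qed.

Lemma subspaceB A x y : is_subspace A -> A x -> A y -> A (x - y).
Proof. by move=> sA Ax Ay; apply: subspaceD => //; apply: subspaceN. Qed.

Lemma lin_span_subspace S : is_subspace (lin_span S).
Proof.
split=> [A [sA _]|a x y Sx Sy A AP]; first exact: subspace0.
by have [sA _] := AP; apply: sA.2; [apply: Sx|apply: Sy].
Qed.

Lemma lin_span_in S x : S x -> lin_span S x.
Proof. exact: sub_gen_smallest. Qed.

Lemma lin_span_sub S A : is_subspace A -> S `<=` A -> lin_span S `<=` A.
Proof. exact: smallest_sub. Qed.

End Subspaces.

Lemma preimage_subspace (F : fieldType) (V W : lmodType F)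
    (f : {linear V -> W}) (A : set W) :
  is_subspace A -> is_subspace (f @^-1` A).
Proof.
move=> sA; split=> [|a x y Ax Ay]; rewrite /preimage /= ?linear0 ?linearP.
  exact: subspace0.
exact: sA.2.
Qed.

Lemma ker_subspace (F : fieldType) (V W : lmodType F) (f : {linear V -> W}) :
  is_subspace [set x | f x = 0].
Proof.
apply: (preimage_subspace f (A := [set 0])).
by split=> [|a _ _ -> ->] //=; rewrite scaler0 addr0.
Qed.

Lemma image_subspace (F : fieldType) (V W : lmodType F)
    (f : {linear V -> W}) (A : set V) :
  is_subspace A -> is_subspace (f @` A).
Proof.
move=> sA; split=> [|a _ _ [x Ax <-] [y Ay <-]].
  by exists 0; [exact: subspace0|rewrite linear0].
by exists (a *: x + y); [exact: sA.2|rewrite linearP].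
Qed.

(** * Generated subalgebras and products of subspaces *)

Section Subalgebras.
Variables (F : fieldType) (U : algType F).
Implicit Types A B C S : set U.

Definition alg_gen S : set U := smallest (@is_subalgebra F U) S.

Lemma alg_gen_subalgebra S : is_subalgebra (alg_gen S).
Proof.
split=> [|A [[]]//|x y Sx Sy A AP].
  split=> [A [[sA _ _] _]|a x y Sx Sy A AP]; first exact: subspace0.
  by have [[sA _ _] _] := AP; apply: sA.2; [apply: Sx|apply: Sy].
by have [[_ _ sA] _] := AP; apply: sA; [apply: Sx|apply: Sy].
Qed.

Lemma alg_gen_subspace S : is_subspace (alg_gen S).
Proof. by case: (alg_gen_subalgebra S). Qed.

Lemma alg_gen1 S : alg_gen S 1.
Proof. by case: (alg_gen_subalgebra S). Qed.

Lemma alg_genM S x y : alg_gen S x -> alg_gen S y -> alg_gen S (x * y).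
Proof. by case: (alg_gen_subalgebra S) => _ _; apply. Qed.

Lemma alg_gen_in S x : S x -> alg_gen S x.
Proof. exact: sub_gen_smallest. Qed.

Lemma alg_gen_sub S A : is_subalgebra A -> S `<=` A -> alg_gen S `<=` A.
Proof. exact: smallest_sub. Qed.

Lemma alg_genS S S' : S `<=` S' -> alg_gen S `<=` alg_gen S'.
Proof.
move=> sub; apply: alg_gen_sub; first exact: alg_gen_subalgebra.
by move=> x /sub; apply: alg_gen_in.
Qed.

(** The left multipliers of [A] into itself form a subalgebra; it contains [S], hence [alg_gen S],
    and is evaluated at [1]. *)
Lemma alg_gen_left_ind S A : is_subspace A -> A 1 ->
  (forall s x, S s -> A x -> A (s * x)) -> alg_gen S `<=` A.
Proof.
move=> sA A1 AS a Sa; rewrite -[a]mulr1; move: A1; move: a Sa (1 : U).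
apply: (@alg_gen_sub S [set a | forall x, A x -> A (a * x)]); last first.
  by move=> s Ss x; apply: AS.
split=> [|x|x y Ax Ay z Az] /=; rewrite ?mul1r -?mulrA //; last exact/Ax/Ay.
split=> [x _|a x y Ax Ay z Az]; first by rewrite mul0r; apply: subspace0.
by rewrite mulrDl -scalerAl; apply: sA.2; [apply: Ax|apply: Ay].
Qed.

Lemma set_mul_subspace A B : is_subspace (set_mul A B).
Proof. exact: lin_span_subspace. Qed.

Lemma set_mul_in A B a b : A a -> B b -> set_mul A B (a * b).
Proof. by move=> Aa Bb; apply: lin_span_in; exists a => //; exists b. Qed.

Lemma set_mul_sub A B C : is_subspace C ->
  (forall a b, A a -> B b -> C (a * b)) -> set_mul A B `<=` C.
Proof.
by move=> sC ABC; apply: lin_span_sub => // _ [a Aa [b Bb <-]]; apply: ABC.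
Qed.

Lemma set_mulS A A' B B' : A `<=` A' -> B `<=` B' ->
  set_mul A B `<=` set_mul A' B'.
Proof.
move=> sA sB; apply: set_mul_sub; first exact: set_mul_subspace.
by move=> a b /sA A'a /sB; apply: set_mul_in.
Qed.

Lemma mulr_preim_subspace C u : is_subspace C -> is_subspace [set z | C (z * u)].
Proof.
move=> sC; split=> /= [|a x y Cx Cy]; first by rewrite mul0r; apply: subspace0.
by rewrite mulrDl -scalerAl; apply: sC.2.
Qed.

Lemma mull_preim_subspace C u : is_subspace C -> is_subspace [set z | C (u * z)].
Proof.
move=> sC; split=> /= [|a x y Cx Cy]; first by rewrite mulr0; apply: subspace0.
by rewrite mulrDr -scalerAr; apply: sC.2.
Qed.

Lemma set_mulA A B C :
  set_mul A (set_mul B C) = set_mul (set_mul A B) C.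
Proof.
apply/seteqP; split; apply: set_mul_sub; try exact: set_mul_subspace.
  move=> a z Aa; move: z.
  apply: (@set_mul_sub _ _ [set z | set_mul (set_mul A B) C (a * z)])
    => [|b c Bb Cc].
    by apply: mull_preim_subspace; apply: set_mul_subspace.
  by rewrite /= mulrA; do 2?[apply: set_mul_in => //].
move=> z c + Cc; move: z.
apply: (@set_mul_sub _ _ [set z | set_mul A (set_mul B C) (z * c)])
  => [|a b Aa Bb].
  by apply: mulr_preim_subspace; apply: set_mul_subspace.
by rewrite /= -mulrA; do 2?[apply: set_mul_in => //].
Qed.

Lemma set_mul3_sub A B C D : is_subspace D ->
  (forall a b c, A a -> B b -> C c -> D (a * b * c)) ->
  set_mul (set_mul A B) C `<=` D.
Proof.
move=> sD ABC; apply: set_mul_sub => // z c + Cc; move: z.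
apply: (@set_mul_sub _ _ [set z | D (z * c)]).
  exact: mulr_preim_subspace.
by move=> a b Aa Bb; apply: ABC.
Qed.

Lemma set_mul3_in A B C a b c : A a -> B b -> C c ->
  set_mul (set_mul A B) C (a * b * c).
Proof. by move=> Aa Bb Cc; do 2?[apply: set_mul_in => //]. Qed.

Lemma sub_set_one_mul A : A `<=` set_mul (@set_one F U) A.
Proof.
by move=> a Aa; rewrite -[a]mul1r; apply: set_mul_in => //; apply: lin_span_in.
Qed.

Lemma sub_set_mul_one A : A `<=` set_mul A (@set_one F U).
Proof.
by move=> a Aa; rewrite -[a]mulr1; apply: set_mul_in => //; apply: lin_span_in.
Qed.

End Subalgebras.

(** * The converse algebra *)

Section Converse.
Variable F : fieldType.

(** The scalar action is unchanged, so subspaces and spans of the converse are convertible with the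
    original ones. *)
HB.instance Definition _ (V : lmodType F) :=
  GRing.Zmodule_isLmodule.Build F V^c
    (@scalerA F V) (@scale1r F V) (@scalerDr F V) (fun v a b => @scalerDl F V v a b).

Variable U : algType F.

Let converse_scalerAl (a : F) (x y : U^c) : a *: (x * y) = (a *: x) * y.
Proof. exact: (@scalerAr F U a y x). Qed.

HB.instance Definition _ :=
  GRing.Lmodule_isLalgebra.Build F U^c converse_scalerAl.

Let converse_scalerAr (a : F) (x y : U^c) : a *: (x * y) = x * (a *: y).
Proof. exact: (@scalerAl F U a y x). Qed.

HB.instance Definition _ :=
  GRing.Lalgebra_isAlgebra.Build F U^c converse_scalerAr.

Lemma converse_set_mul (A B : set U) :
  set_mul (U := U^c) A B = set_mul B A.
Proof.
apply: (congr1 (@lin_span F U)); apply/seteqP.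
by split=> _ [a Aa [b Bb <-]]; exists b => //; exists a.
Qed.

Lemma converse_alg_gen (S : set U) : alg_gen (U := U^c) S = alg_gen S.
Proof.
apply: (congr1 (fun P => smallest P S)); apply/funext=> A; apply/propext.
by split=> -[sA A1 AM]; split=> // x y Ax Ay; apply: AM.
Qed.

End Converse.

(** * Triangular decomposition and coroots *)

Section Triangular.
Variables (F : fieldType) (l : nat).

(** [S] stands for the image of the Cartan subalgebra and [hs] for the coroots. Weights enter only
    through the existence of [c], which makes the relations symmetric under passing to [U^c] with
    [E] and [G] exchanged. *)
Definition triangular_relations (U : algType F) (E G : 'I_l -> U)
    (hs : 'I_l -> U) (S : set U) : Prop :=
  [/\ forall x y, S x -> S y -> x * y = y * x,
      forall x i, S x -> exists c : F, E i * x = (x + c%:A) * E i,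
      forall x i, S x -> exists c : F, G i * x = (x + c%:A) * G i,
      forall i k, E i * G k = G k * E i + (if i == k then hs i else 0)
    & forall i, S (hs i)].

Definition triangular_span (U : algType F) (E G : 'I_l -> U) (T : set U) :=
  set_mul (set_mul (alg_gen (range G)) (alg_gen T)) (alg_gen (range E)).

End Triangular.

Section Relations.
Variables (F : fieldType) (U : algType F) (l : nat).
Variables (E G : 'I_l -> U) (hs : 'I_l -> U) (S : set U).
Hypothesis rel : triangular_relations E G hs S.

Local Notation Am := (alg_gen (range G)).
Local Notation Ap := (alg_gen (range E)).

Let Am_subspace : is_subspace Am. Proof. exact: alg_gen_subspace. Qed.

Lemma AmG k : Am (G k). Proof. by apply: alg_gen_in; exists k. Qed.

(** Since [ad x] is a derivation, the elements of [Am] that it maps into [Am] form a subalgebra, and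
    each [G k] is one of them. *)
Lemma cartan_mul_minus x z : S x -> Am z ->
  exists2 z', Am z' & x * z = z * x + z'.
Proof.
move=> Sx; have [_ _ wtG _ _] := rel.
suff: Am `<=` [set z | Am z /\ exists2 z', Am z' & x * z = z * x + z'].
  by move=> sub /sub [].
apply: alg_gen_sub => {z} [|_ [k _ <-]]; last first.
  split; first exact: AmG.
  have [c Gx] := wtG x k Sx.
  exists (- c *: G k); first by apply: (subspaceZ _ Am_subspace); apply: AmG.
  by rewrite Gx mulrDl -scalerAl mul1r scaleNr addrK.
split=> [||y z [Ay [y' Ay' xy]] [Az [z' Az' xz]]].
- split=> [|a y z [Ay [y' Ay' xy]] [Az [z' Az' xz]]].
    split; first exact: subspace0.
    by exists 0; [exact: subspace0|rewrite mulr0 mul0r addr0].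
  split; first exact: Am_subspace.2.
  exists (a *: y' + z'); first exact: Am_subspace.2.
  by rewrite mulrDr mulrDl -scalerAr -scalerAl xy xz scalerDr addrACA.
- split; first exact: alg_gen1.
  by exists 0; [exact: subspace0|rewrite mulr1 mul1r addr0].
split; first exact: alg_genM.
exists (y * z' + y' * z).
  by apply: (subspaceD Am_subspace); apply: alg_genM.
by rewrite mulrA xy mulrDl -mulrA xz mulrDr mulrA addrA.
Qed.

(* Graph of the derivation y |-> x of [Am] such that [E_i, y] = x h_i modulo
   [Am]; without the PBW theorem x is not known to be unique. *)
Definition partial_rel (i : 'I_l) (y x : U) : Prop :=
  [/\ Am y, Am x & exists2 b, Am b & E i * y = y * E i + x * hs i + b].

Lemma partial_rel_lin i a y x y' x' : partial_rel i y x ->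
  partial_rel i y' x' -> partial_rel i (a *: y + y') (a *: x + x').
Proof.
move=> [Ay Ax [b Ab Ey]] [Ay' Ax' [b' Ab' Ey']].
split; [exact: Am_subspace.2|exact: Am_subspace.2|].
exists (a *: b + b'); first exact: Am_subspace.2.
rewrite mulrDr -scalerAr Ey Ey' !mulrDl -!scalerAl !scalerDr.
by rewrite addrACA (addrACA (a *: (y * E i))).
Qed.

(** Leibniz rule. Moving [E i] past [y] leaves [x * hs i] in front of [y']; commuting [hs i] past
    [y'] costs only a term of [Am]. *)
Lemma partial_relM i y x y' x' : partial_rel i y x -> partial_rel i y' x' ->
  partial_rel i (y * y') (x * y' + y * x').
Proof.
move=> [Ay Ax [b Ab Ey]] [Ay' Ax' [b' Ab' Ey']].
have [_ _ _ _ Shs] := rel.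
have [z Az hy'] := cartan_mul_minus (Shs i) Ay'.
split; [exact: alg_genM|by apply: (subspaceD Am_subspace); apply: alg_genM|].
exists (x * z + b * y' + y * b').
  by do 2?[apply: (subspaceD Am_subspace)]; apply: alg_genM.
rewrite mulrA Ey !mulrDl -!mulrA hy' Ey' !mulrDr !mulrA.
move: (y * y' * E i) (y * x' * hs i) (y * b') (x * y' * hs i) (x * z) (b * y').
by move=> p q r s t u; rewrite [LHS](AC (3*2*1) ((1*(4*2))*(5*6*3))).
Qed.

Lemma partial_rel_const i a : partial_rel i (a *: 1) 0.
Proof.
split; [apply: (subspaceZ _ Am_subspace); exact: alg_gen1|exact: subspace0|].
exists 0; first exact: subspace0.
by rewrite mul0r !addr0 -scalerAl -scalerAr mulr1 mul1r.
Qed.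

Lemma partial_rel_image_subspace i :
  is_subspace [set x | exists y, partial_rel i y x].
Proof.
split=> [|a x y [x' Px] [y' Py]]; first by eexists; apply: partial_rel_const 0.
by eexists; apply: partial_rel_lin Px Py.
Qed.

Lemma partial_rel_gen i k : partial_rel i (G k) (i == k)%:R.
Proof.
have [_ _ _ EG _] := rel; split; first exact: AmG.
  by case: eqP => _; [exact: alg_gen1|exact: subspace0].
exists 0; first exact: subspace0.
by rewrite EG addr0; case: eqP => _; rewrite ?mul1r ?mul0r.
Qed.

Lemma partial_rel_pow i k : partial_rel i (G i ^+ k.+1) (k.+1%:R *: G i ^+ k).
Proof.
elim: k => [|k IHk].
  by rewrite expr1 expr0 scale1r; have := partial_rel_gen i i; rewrite eqxx.
have := partial_relM IHk (partial_rel_gen i i).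
rewrite -exprSr eqxx mulr1 -scalerAl -exprSr -{2}[G i ^+ k.+1]scale1r -scalerDl.
by rewrite natr1.
Qed.

Lemma partial_rel_ex i y : Am y -> exists x, partial_rel i y x.
Proof.
move: y; apply: alg_gen_sub => [|_ [k _ <-]]; last first.
  by exists (i == k)%:R; apply: partial_rel_gen.
split=> [||y z [y' Py] [z' Pz]]; last by eexists; apply: partial_relM Py Pz.
  split=> [|a y z [y' Py] [z' Pz]]; last by eexists; apply: partial_rel_lin Py Pz.
  by exists 0; have := partial_rel_const i 0; rewrite scale0r.
by exists 0; have := partial_rel_const i 1; rewrite scale1r.
Qed.

(** The bound is strict, so [minus_words 0] is the zero space and can serve as base case of an
    induction. *)
Definition minus_words n : set U :=
  lin_span [set w | exists2 s : seq 'I_l, (size s < n)%N & w = \prod_(k <- s) G k].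

Lemma minus_words_subspace n : is_subspace (minus_words n).
Proof. exact: lin_span_subspace. Qed.

Lemma minus_wordsS n m : (n <= m)%N -> minus_words n `<=` minus_words m.
Proof.
move=> nm; apply: lin_span_sub => [|_ [s sn ->]].
  exact: minus_words_subspace.
by apply: lin_span_in; exists s => //; apply: leq_trans nm.
Qed.

Lemma minus_words_mul k n w : minus_words n w -> minus_words n.+1 (G k * w).
Proof.
move: w; apply: lin_span_sub => [|_ [s sn ->]].
  exact/mull_preim_subspace/minus_words_subspace.
by apply: lin_span_in; exists (k :: s); rewrite ?big_cons.
Qed.

(** By the product rule, every term of the derivative deletes one occurrence of the letter [i], so
    only shorter words appear. *)
Lemma partial_rel_word i (s : seq 'I_l) :
  exists2 x, minus_words (size s) x & partial_rel i (\prod_(k <- s) G k) x.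
Proof.
elim: s => [|k s [x sx Px]] /=.
  exists 0; first exact: subspace0 (minus_words_subspace _).
  by have := partial_rel_const i 1; rewrite scale1r big_nil.
rewrite big_cons; eexists; last exact: partial_relM (partial_rel_gen i k) Px.
apply: (subspaceD (minus_words_subspace _)).
  case: eqP => _; last by rewrite mul0r; exact: subspace0 (minus_words_subspace _).
  by rewrite mul1r; apply: lin_span_in; exists s.
exact: minus_words_mul.
Qed.

Hypothesis charF0 : [pchar F] =i pred0.

(* Integration by parts: [G_i^k w] is, up to the factor k + 1, the image of
   [G_i^(k+1) w] minus [G_i^(k+1) w'], where [w'] has shorter words. *)
Lemma partial_rel_onto_word i n w : minus_words n w ->
  forall k, exists y, partial_rel i y (G i ^+ k * w).
Proof.
elim: n w => [|n IHn].
  apply: lin_span_sub => [|_ [s //]].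
  split=> [k|a x y Px Py k].
    by rewrite mulr0; apply: subspace0 (partial_rel_image_subspace i).
  rewrite mulrDr -scalerAr.
  exact: (partial_rel_image_subspace i).2 (Px k) (Py k).
apply: lin_span_sub => [|_ [s sn ->] k].
  split=> [k|a x y Px Py k].
    by rewrite mulr0; apply: subspace0 (partial_rel_image_subspace i).
  rewrite mulrDr -scalerAr.
  exact: (partial_rel_image_subspace i).2 (Px k) (Py k).
rewrite ltnS in sn; have [x sx Px] := partial_rel_word i s.
(* The derivative [x] of the word is shorter, but comes with exponent [k.+1]: hence the
   quantification over all [k] in the induction. *)
have [y Py] := IHn x (minus_wordsS sn sx) k.+1.
have Pz := partial_relM (partial_rel_pow i k) Px.
have k0 : k.+1%:R != 0 :> F by rewrite (iffLR (pcharf0P F) charF0).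
(* The difference of [Pz] and [Py] is rescaled; the zero constant only fills the second summand of
   [partial_rel_lin]. *)
have := partial_rel_lin (k.+1%:R^-1) (partial_rel_lin (-1) Py Pz)
  (partial_rel_const i 0).
rewrite !scale0r !addr0 !scaleN1r addrCA addNr addr0.
rewrite -!scalerAl scalerA mulVf // scale1r => P; by eexists; apply: P.
Qed.

Lemma partial_rel_onto i x : Am x -> exists y, partial_rel i y x.
Proof.
have words : Am `<=` lin_span (range (fun s : seq 'I_l => \prod_(k <- s) G k)).
  apply: alg_gen_left_ind => [||_ y [k _ <-]]; first exact: lin_span_subspace.
    by apply: lin_span_in; exists [::]; rewrite ?big_nil.
  move: y; apply: lin_span_sub => [|_ [s _ <-]].
    exact/mull_preim_subspace/lin_span_subspace.
  by apply: lin_span_in; exists (k :: s); rewrite ?big_cons.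
move=> /words; move: x; apply: lin_span_sub => [|_ [s _ <-]].
  exact: partial_rel_image_subspace.
have [] := @partial_rel_onto_word i (size s).+1 (\prod_(k <- s) G k) _ 0.
  by apply: lin_span_in; exists s.
by rewrite expr0 mul1r => y Py; exists y.
Qed.

Lemma partial_rel_comm i y x : partial_rel i y x ->
  exists2 b, Am b & x * hs i = E i * y - y * E i - b.
Proof.
case=> _ _ [b Ab ->]; exists b => //.
by rewrite addrAC addrK addrC addKr.
Qed.

(** Passing [E i] shifts each generator [t] to [t + c], which stays in [alg_gen T]; this extends to
    sums and products. *)
Lemma raising_cartan i (T : set U) v : T `<=` S -> alg_gen T v ->
  exists2 v', alg_gen T v' & E i * v = v' * E i.
Proof.
have [_ wtE _ _ _] := rel; move=> TS.
move: v; apply: alg_gen_sub => [|t Tt]; last first.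
  have [c Et] := wtE t i (TS _ Tt); exists (t + c%:A) => //.
  apply: (subspaceD (alg_gen_subspace _)); first exact: alg_gen_in.
  by apply: (subspaceZ _ (alg_gen_subspace _)); apply: alg_gen1.
split=> [||x y [x' Tx Ex] [y' Ty Ey]].
- split=> [|a x y [x' Tx Ex] [y' Ty Ey]].
    by exists 0; [exact: subspace0 (alg_gen_subspace _)|rewrite mulr0 mul0r].
  exists (a *: x' + y'); first exact: (alg_gen_subspace _).2.
  by rewrite mulrDr mulrDl -scalerAr -scalerAl Ex Ey.
- by exists 1; [exact: alg_gen1|rewrite mulr1 mul1r].
by exists (x' * y'); [exact: alg_genM|rewrite mulrA Ex -mulrA Ey mulrA].
Qed.

Lemma triangular_span1 T : triangular_span E G T 1.
Proof.
rewrite -[1]mulr1 -[1 in X in X * _]mulr1.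
by apply: set_mul3_in; apply: alg_gen1.
Qed.

(** The triangular span contains [1] and is stable under left multiplication by each generator. *)
Lemma triangular_decomposition :
  alg_gen (S `|` range E `|` range G) `<=` triangular_span E G S.
Proof.
have [_ _ _ _ Shs] := rel.
have sT : is_subspace (triangular_span E G S) by apply: set_mul_subspace.
apply: alg_gen_left_ind => // [|s y Ss]; first exact: triangular_span1.
move: y; apply: set_mul3_sub => [|x v u Ax Tv Au].
  exact: mull_preim_subspace.
case: Ss => [[Ss|[i _ <-]]|[i _ <-]]; rewrite /= !mulrA.
- have [z Az ->] := cartan_mul_minus Ss Ax.
  rewrite !mulrDl; apply: (subspaceD sT); last exact: set_mul3_in.
  rewrite -[x * s * v]mulrA; apply: set_mul3_in => //.
  by apply: alg_genM Tv; apply: alg_gen_in.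
(* [E i * x] splits into [x * E i], whose [E i] moves on to the right factor, a term [x' * hs i]
   absorbed by the Cartan factor, and [b] in [Am]. *)
- have [x' [_ Ax' [b Ab ->]]] := partial_rel_ex i Ax.
  rewrite !mulrDl; do 2?[apply: (subspaceD sT)]; last exact: set_mul3_in.
    have [v' Tv' Ev] := raising_cartan i (@subset_refl _ S) Tv.
    rewrite -[x * _ * v]mulrA Ev mulrA -[_ * E i * u]mulrA.
    by apply: set_mul3_in => //; apply: alg_genM Au; apply: alg_gen_in; exists i.
  rewrite -[x' * _ * v]mulrA; apply: set_mul3_in => //.
  by apply: alg_genM Tv; apply: alg_gen_in.
by apply: set_mul3_in => //; apply: alg_genM => //; apply: AmG.
Qed.

(** * Trading one coroot for a root vector factor *)

Section AdjoinCoroot.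
Variables (T : set U) (i : 'I_l).
Hypothesis TS : T `<=` S.

(* Polynomials of degree at most [n] in [hs i] over [alg_gen T]. *)
Fixpoint cartan_poly n : set U :=
  if n is m.+1 then [set hs i * a + b | a in cartan_poly m & b in cartan_poly m]
  else alg_gen T.

Lemma cartan_poly_subspace n : is_subspace (cartan_poly n).
Proof.
elim: n => [|n [D0 DP]] /=; first exact: alg_gen_subspace.
split=> [|c _ _ [x Dx [y Dy <-]] [x' Dx' [y' Dy' <-]]].
  by exists 0 => //; exists 0 => //; rewrite mulr0 addr0.
exists (c *: x + x'); first exact: DP.
exists (c *: y + y'); first exact: DP.
by rewrite scalerDr mulrDr -scalerAr addrACA.
Qed.

Lemma cartan_poly_mulh n v : cartan_poly n v -> cartan_poly n.+1 (hs i * v).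
Proof.
move=> Dv; exists v => //; exists 0; last by rewrite addr0.
exact: subspace0 (cartan_poly_subspace n).
Qed.

Lemma cartan_polyS n m : (n <= m)%N -> cartan_poly n `<=` cartan_poly m.
Proof.
move=> /subnK <-; elim: (m - n)%N => [|k IHk] //= v /IHk Dv.
exists 0; first exact: subspace0 (cartan_poly_subspace _).
by exists v => //; rewrite mulr0 add0r.
Qed.

Lemma cartan_poly_mulT n t v : T t -> cartan_poly n v -> cartan_poly n (t * v).
Proof.
have [comm _ _ _ Shs] := rel; move=> Tt.
elim: n v => [v Tv|n IHn _ [x Dx [y Dy <-]]] /=.
  by apply: alg_genM Tv; apply: alg_gen_in.
exists (t * x); [exact: IHn|exists (t * y); first exact: IHn].
by rewrite mulrDr !mulrA; congr (_ * _ + _); apply: comm => //; apply: TS.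
Qed.

(** Left multiplication by an element of [T] preserves the degree, as it commutes with [hs i], and
    multiplication by [hs i] raises it by one. *)
Lemma alg_gen_cartan_poly v :
  alg_gen (T `|` [set hs i]) v -> exists n, cartan_poly n v.
Proof.
move: v; apply: alg_gen_left_ind => [||s x [Ts [n Dx]|-> [n Dx]]].
- split=> [|a x y [n Dx] [m Dy]].
    by exists 0; exact: subspace0 (cartan_poly_subspace _).
  exists (maxn n m); apply: (cartan_poly_subspace _).2.
    by apply: cartan_polyS Dx; apply: leq_maxl.
  by apply: cartan_polyS Dy; apply: leq_maxr.
- by exists 0; apply: alg_gen1.
- by exists n; apply: cartan_poly_mulT.
by exists n.+1; apply: cartan_poly_mulh.
Qed.

(** The substitution of [hs i + c] for [hs i] does not raise the degree. *)
Lemma raising_cartan_poly n v : cartan_poly n v ->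
  exists2 v', cartan_poly n v' & E i * v = v' * E i.
Proof.
have [_ wtE _ _ Shs] := rel; have [c Eh] := wtE _ i (Shs i).
elim: n v => [|n IHn]; first by move=> v; apply: raising_cartan.
move=> _ [x /IHn [x' Dx' Ex] [y /IHn [y' Dy' Ey] <-]].
exists (hs i * x' + (c *: x' + y')).
  by exists x' => //; eexists; last reflexivity; apply: (cartan_poly_subspace _).2.
rewrite mulrDr mulrA Eh Ey -mulrA Ex mulrDl !mulrA addrA [RHS]mulrDl; congr (_ + _).
by rewrite [RHS]mulrDl -scalerAl -scalerAl mul1r -scalerAl.
Qed.

(** Induction on the degree in [hs i]: writing [x * hs i] as [E i * y - y * E i - d] lowers the
    degree of every term by one. *)
Lemma adjoin_coroot_left : triangular_span E G (T `|` [set hs i]) `<=`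
  set_mul (alg_gen [set E i]) (triangular_span E G T).
Proof.
set Y := set_mul _ _; have sY : is_subspace Y by apply: set_mul_subspace.
have EY y : Y y -> Y (E i * y).
  move: y; apply: set_mul_sub => [|a z Ea Tz].
    exact: mull_preim_subspace.
  rewrite /= mulrA; apply: set_mul_in => //.
  by apply: alg_genM Ea; apply: alg_gen_in.
suff key n : forall x v u, Am x -> cartan_poly n v -> Ap u -> Y (x * v * u).
  by apply: set_mul3_sub => // x v u Ax /alg_gen_cartan_poly [n Dv]; apply: key Dv.
elim: n => [|n IHn] x v u Ax Dv Au.
  by rewrite -[_ * u]mul1r; apply: set_mul_in; [apply: alg_gen1|apply: set_mul3_in].
case: Dv => a Da [b Db <-]; rewrite mulrDr mulrDl.
apply: (subspaceD sY); last exact: IHn.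
have [y Py] := partial_rel_onto i Ax; have [Ay _ _] := Py.
have [d Ad xh] := partial_rel_comm Py.
have [a' Da' Ea] := raising_cartan_poly Da.
(* The leading [E i] is absorbed by [Y]; in the middle term [E i] passes the polynomial [a] and
   joins [u]. *)
rewrite mulrA xh !mulrBl; do 2?[apply: (subspaceB sY)]; last exact: IHn.
  by rewrite -!mulrA; apply: EY; rewrite mulrA; apply: IHn.
rewrite -[y * _ * a]mulrA Ea mulrA -[_ * E i * u]mulrA; apply: IHn => //.
by apply: alg_genM Au; apply: alg_gen_in; exists i.
Qed.

End AdjoinCoroot.
End Relations.

(** Reversing products changes the sign of each shift [c]. In the relation between [E] and [G] the
    reversal is undone by exchanging the two families, so the coroots keep their sign. *)
Lemma converse_triangular (F : fieldType) (U : algType F) l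
    (E G hs : 'I_l -> U) (S : set U) :
  triangular_relations E G hs S ->
  triangular_relations (U := U^c) (G : 'I_l -> U^c) (E : 'I_l -> U^c) hs S.
Proof.
move=> [comm wtE wtG EG Shs]; split=> // [x y Sx Sy|x i Sx|x i Sx|i k].
- exact: comm.
- have [c Gx] := wtG x i Sx; exists (- c).
  change ((x : U) * G i = (G i : U) * (x + (- c)%:A)).
  by rewrite mulrDr Gx mulrDl -scalerAr -scalerAl mulr1 mul1r scaleNr addrK.
- have [c Ex] := wtE x i Sx; exists (- c).
  change ((x : U) * E i = (E i : U) * (x + (- c)%:A)).
  by rewrite mulrDr Ex mulrDl -scalerAr -scalerAl mulr1 mul1r scaleNr addrK.
change ((E k : U) * G i = (G i : U) * E k + (if i == k then hs i else 0)).
by rewrite EG eq_sym; case: eqP => [->|].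
Qed.

(** With the two families exchanged, the triangular span in [U^c] is the original one, up to
    associativity. *)
Lemma adjoin_coroot_right (F : fieldType) (U : algType F) l
    (E G hs : 'I_l -> U) (S T : set U) (i : 'I_l) :
  triangular_relations E G hs S -> [pchar F] =i pred0 -> T `<=` S ->
  triangular_span E G (T `|` [set hs i]) `<=`
    set_mul (triangular_span E G T) (alg_gen [set G i]).
Proof.
move=> /converse_triangular rel charF0 TS.
have := adjoin_coroot_left rel charF0 (i := i) TS.
by rewrite /triangular_span !converse_set_mul !converse_alg_gen -!set_mulA.
Qed.

(** * Trading several coroots, one after the other *)

Section Iteration.
Variables (F : fieldType) (U : algType F) (l : nat).
Variables (E G hs : 'I_l -> U) (S : set U).
Hypotheses (rel : triangular_relations E G hs S) (charF0 : [pchar F] =i pred0).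

Lemma triangular_spanS (T T' : set U) :
  T `<=` T' -> triangular_span E G T `<=` triangular_span E G T'.
Proof. by move=> TT'; do 2?[apply: set_mulS => //]; apply: alg_genS. Qed.

Lemma adjoin_coroots_left (X : 'I_l -> set U) (r : seq 'I_l) (T : set U) :
  (forall i, alg_gen [set E i] `<=` X i) -> T `<=` S ->
  triangular_span E G (T `|` [set hs i | i in [set` r]]) `<=`
    set_mul (\big[@set_mul F U/@set_one F U]_(i <- r) X i) (triangular_span E G T).
Proof.
have [_ _ _ _ Shs] := rel; move=> EX TS; elim: r => [|i r IHr].
  rewrite big_nil => y Ty; apply: sub_set_one_mul; apply: triangular_spanS Ty.
  by move=> x [//|[i]].
rewrite big_cons -set_mulA.
have T'S : T `|` [set hs i | i in [set` r]] `<=` S by move=> x [/TS//|[k _ <-]].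
move=> y Ty; apply: (set_mulS (EX i) IHr).
(* The head of the list is traded first, so its factor ends up leftmost. *)
apply: (adjoin_coroot_left rel charF0 T'S); apply: triangular_spanS Ty.
move=> x [Tx|[k]]; first by do 2!left.
by rewrite /= inE => /orP[/eqP->|rk] <-; [right|left; right; exists k].
Qed.

Lemma adjoin_coroots_right (X : 'I_l -> set U) (r : seq 'I_l) (T : set U) :
  (forall i, alg_gen [set G i] `<=` X i) -> T `<=` S ->
  triangular_span E G (T `|` [set hs i | i in [set` r]]) `<=`
    set_mul (triangular_span E G T) (\big[@set_mul F U/@set_one F U]_(i <- r) X i).
Proof.
have [_ _ _ _ Shs] := rel; move=> GX; elim: r T => [|i r IHr] T TS.
  rewrite big_nil => y Ty; apply: sub_set_mul_one; apply: triangular_spanS Ty.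
  by move=> x [//|[i]].
have T'S : T `|` [set hs i] `<=` S by move=> x [/TS//|->].
rewrite big_cons set_mulA => y Ty.
have sub : triangular_span E G (T `|` [set hs i]) `<=`
    set_mul (triangular_span E G T) (X i).
  by move=> z /(adjoin_coroot_right rel charF0 TS); apply: set_mulS.
(* Here the tail is traded first, with the head coroot kept in the base set; the factor of the head
   then lies left of the others. Hence [T] varies in the induction. *)
apply: (set_mulS sub (fun x Xx => Xx)); apply: (IHr _ T'S).
apply: triangular_spanS Ty; move=> x [Tx|[k]]; first by do 2!left.
by rewrite /= inE => /orP[/eqP->|rk] <-; [left; right|right; exists k].
Qed.

End Iteration.

(** * Auxiliary Lie algebras and generation of U *)

Section LieTheory.
Variables (F : fieldType) (L : lieAlgType F).
Implicit Types (x y z : L) (A : set L).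

Lemma bracketDl x y z : bracket (x + y) z = bracket x z + bracket y z.
Proof. by rewrite -[x]scale1r bracketPl !scale1r. Qed.

Lemma bracketDr x y z : bracket z (x + y) = bracket z x + bracket z y.
Proof. by rewrite -[x]scale1r bracketPr !scale1r. Qed.

Lemma bracket0l x : bracket 0 x = 0.
Proof. by apply: (addrI (bracket 0 x)); rewrite -bracketDl !addr0. Qed.

Lemma bracket0r x : bracket x 0 = 0.
Proof. by apply: (addrI (bracket x 0)); rewrite -bracketDr !addr0. Qed.

Lemma bracketNr x y : bracket x (- y) = - bracket x y.
Proof. by apply: (addrI (bracket x y)); rewrite -bracketDr !subrr bracket0r. Qed.

Lemma bracketC x y : bracket x y = - bracket y x.
Proof.
apply/eqP; rewrite -addr_eq0; apply/eqP.
have := bracketxx (x + y); rewrite bracketDl !bracketDr !bracketxx.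
by rewrite add0r addr0.
Qed.

Lemma bracket_bracket x y z :
  bracket x (bracket y z) = bracket (bracket x y) z + bracket y (bracket x z).
Proof.
apply/eqP; rewrite (bracketC (bracket x y)) (bracketC x z) bracketNr.
by rewrite -opprD -addr_eq0 addrCA addrA addrC addrA addrC addrA jacobi.
Qed.

Lemma bracketl_preim_subspace A x :
  is_subspace A -> is_subspace [set y | A (bracket x y)].
Proof.
move=> sA; split=> /= [|a y z Ay Az]; first by rewrite bracket0r; apply: subspace0.
by rewrite bracketPr; apply: sA.2.
Qed.

End LieTheory.

(** A separate name for [U] with the commutator bracket, so that the presentation of [gt] can be
    applied to it. *)
Definition commutator_lie (U : Type) : Type := U.

Section CommutatorLie.
Variables (F : fieldType) (U : algType F).

HB.instance Definition _ := GRing.Lmodule.on (commutator_lie U).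

Let comm_bracket (x y : commutator_lie U) : commutator_lie U :=
  (x : U) * y - (y : U) * x.

Let comm_bracketPl (a : F) x y z :
  comm_bracket (a *: x + y) z = a *: comm_bracket x z + comm_bracket y z.
Proof.
rewrite /comm_bracket (@mulrDl U) (@mulrDr U) -scalerAl -scalerAr scalerBr opprD.
by rewrite addrACA.
Qed.

Let comm_bracketPr (a : F) x y z :
  comm_bracket z (a *: x + y) = a *: comm_bracket z x + comm_bracket z y.
Proof.
rewrite /comm_bracket (@mulrDl U) (@mulrDr U) -scalerAl -scalerAr scalerBr opprD.
by rewrite addrACA.
Qed.

Let comm_bracketxx x : comm_bracket x x = 0. Proof. exact: subrr. Qed.

Let comm_jacobi x y z :
  comm_bracket x (comm_bracket y z) + comm_bracket y (comm_bracket z x)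
    + comm_bracket z (comm_bracket x y) = 0.
Proof.
suff jac (a b c : U) : (a * (b * c - c * b) - (b * c - c * b) * a)
    + (b * (c * a - a * c) - (c * a - a * c) * b)
    + (c * (a * b - b * a) - (a * b - b * a) * c) = 0 by exact: jac.
rewrite !mulrBl !mulrBr !mulrA !opprB.
(* The twelve monomials are grouped into six cancelling pairs. *)
rewrite [LHS](AC (((2*2)*(2*2))*(2*2))
  ((1*12)*(2*7)*(3*10)*(4*5)*(6*11)*(8*9))).
by rewrite /= !subrr !addNr !addr0.
Qed.

HB.instance Definition _ := isLieAlgebra.Build F (commutator_lie U)
  comm_bracketPl comm_bracketPr comm_bracketxx comm_jacobi.

End CommutatorLie.

(** Target of the morphism that kills all [e i] and [f i] in [cartan_derived]. *)
Definition abelian_lie (V : Type) : Type := V.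

Section AbelianLie.
Variables (F : fieldType) (V : lmodType F).

HB.instance Definition _ := GRing.Lmodule.on (abelian_lie V).

Let zero_bracket (x y : abelian_lie V) : abelian_lie V := 0.

Let zero_bracketP (a : F) (x y : abelian_lie V) : 0 = a *: 0 + 0 :> abelian_lie V.
Proof. by rewrite scaler0 addr0. Qed.

Let zero_jacobi (x y z : abelian_lie V) : 0 + 0 + 0 = 0 :> abelian_lie V.
Proof. by rewrite !addr0. Qed.

HB.instance Definition _ := isLieAlgebra.Build F (abelian_lie V)
  (bracket := zero_bracket) (fun a x y z => zero_bracketP a x y)
  (fun a x y z => zero_bracketP a x y) (fun=> erefl) zero_jacobi.

End AbelianLie.

Section GeneratedEnveloping.
Variables (F : fieldType) (U : algType F) (S : set U).

Let in_alg : pred U := fun x => `[< alg_gen S x >].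

(** The generated subalgebra as an algebra in its own right, so that universal properties can be
    applied with it as target. *)
Record alg_gen_type := AlgGen { alg_gen_val : U; _ : in_alg alg_gen_val }.

HB.instance Definition _ := [isSub for alg_gen_val].
HB.instance Definition _ := [Choice of alg_gen_type by <:].

Let alg_gen_closed : GRing.subsemialg_closed in_alg.
Proof.
apply: GRing.subalg_closed_semi; split=> [|a x y /asboolP Sx /asboolP Sy|
  x y /asboolP Sx /asboolP Sy]; apply/asboolP; first exact: alg_gen1.
  exact: (alg_gen_subspace S).2.
exact: alg_genM.
Qed.

HB.instance Definition _ :=
  GRing.SubChoice_isSubAlgebra.Build F U in_alg alg_gen_type alg_gen_closed.

Lemma alg_gen_valP (x : alg_gen_type) : alg_gen S (alg_gen_val x).
Proof. by apply/asboolP; case: x. Qed.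

End GeneratedEnveloping.

Section Corestriction.
Variables (F : fieldType) (U : algType F) (S : set U).

Lemma alg_gen_corestriction (V : lmodType F) (k : {linear V -> U}) :
  (forall x, alg_gen S (k x)) ->
  exists k' : {linear V -> alg_gen_type S}, forall x, \val (k' x) = k x.
Proof.
move=> kS; pose k0 x : alg_gen_type S := AlgGen (asboolT (kS x)).
have k0_lin : linear k0.
  by move=> a x y; apply: val_inj; rewrite linearP /= linearP.
pose k' : {linear V -> alg_gen_type S} :=
  HB.pack k0 (GRing.isLinear.Build F V (alg_gen_type S) *:%R k0 k0_lin).
by exists k'.
Qed.

End Corestriction.

Lemma borcherds_chevalley (F : fieldType) (l : nat) (H : vectType F)
    (hc : 'I_l -> H) (alpha : 'I_l -> 'Hom(H, F^o)) (g : lieAlgType F)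
    (h : {linear H -> g}) (e f : 'I_l -> g) :
  is_borcherds_algebra hc alpha h e f -> chevalley_relations hc alpha h e f.
Proof.
case=> gt [ht [et [ft [p [[relt _] [p_morph _] _ [ph pe pf]]]]]].
have [relhh relhe relhf relef] := relt.
split=> [x y|x i|x i|i k].
- by rewrite -!ph /= -p_morph relhh linear0.
- by rewrite -ph -pe /= -p_morph relhe linearZ.
- by rewrite -ph -pf /= -p_morph relhf linearZ.
by rewrite -pe -pf /= -p_morph relef -ph; case: eqP; rewrite ?linear0.
Qed.

(** The presentation shows that [j] takes values in the generated subalgebra [B]. The universal
    property then gives a morphism from [U] to [B] whose composite with the inclusion is the
    identity, so [B] is everything. *)
Lemma enveloping_generated (F : fieldType) (l : nat) (H : vectType F)
    (hc : 'I_l -> H) (alpha : 'I_l -> 'Hom(H, F^o)) (g : lieAlgType F)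
    (h : {linear H -> g}) (e f : 'I_l -> g) (U : algType F)
    (j : {linear g -> U}) :
  is_borcherds_algebra hc alpha h e f -> is_enveloping_algebra j ->
  [set: U] `<=` alg_gen (range (j \o h) `|` range (j \o e) `|` range (j \o f)).
Proof.
move=> g_borcherds; have [hh he hf ef] := borcherds_chevalley g_borcherds.
case: g_borcherds => gt [ht [et [ft [p [[_ pres] [p_morph p_onto] _ [ph pe pf]]]]]].
case=> j_env j_univ; set S := (X in alg_gen X); pose B := alg_gen_type S.
have hS x : alg_gen S ((j \o h) x) by apply: alg_gen_in; left; left; exists x.
have eS i : alg_gen S (j (e i)) by apply: alg_gen_in; left; right; exists i.
have fS i : alg_gen S (j (f i)) by apply: alg_gen_in; right; exists i.
have [hB hBE] := alg_gen_corestriction hS.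
pose eB i : B := AlgGen (asboolT (eS i)).
pose fB i : B := AlgGen (asboolT (fS i)).
have relU : chevalley_relations hc alpha
    (L := commutator_lie U) (j \o h) (j \o e) (j \o f).
  split=> [x y|x i|x i|i k] /=; rewrite -[LHS]j_env.
  - by rewrite hh linear0.
  - by rewrite he linearZ.
  - by rewrite hf linearZ.
  by rewrite ef; case: eqP; rewrite ?linear0.
have val_bracket (x y : commutator_lie B) : \val (bracket x y : B) =
    bracket (\val (x : B) : commutator_lie U) (\val (y : B)).
  by [].
have relB : chevalley_relations hc alpha (L := commutator_lie B) hB eB fB.
  have [Uhh Uhe Uhf Uef] := relU.
  split=> [x y|x i|x i|i k]; apply: (@val_inj U _ B); rewrite val_bracket ?hBE.
  - exact: Uhh.
  - exact: Uhe.
  - exact: Uhf.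
  by rewrite [LHS]Uef; case: eqP => _; rewrite ?hBE.
have jp_S z : alg_gen S (j (p z)).
  have [[phi [phiP phih phie phif]] _] := pres (commutator_lie B) hB eB fB relB.
  pose vphi := (\val : B -> U) \o (phi : {linear gt -> B}).
  have [_ uniq] := pres (commutator_lie U) (j \o h) (j \o e) (j \o f) relU.
  (* Both maps from [gt] to [U] agree on generators, and [vphi] factors through [B]. *)
  have -> : j (p z) = vphi z.
    apply: (uniq (j \o p) vphi); split=> [x y|x|x|x] /=.
    - by rewrite p_morph j_env.
    - by rewrite -ph.
    - by rewrite -pe.
    - by rewrite -pf.
    - by rewrite phiP [LHS]val_bracket.
    - by rewrite -[RHS]hBE; congr \val; apply: phih.
    - by have /= -> := phie x.
    - by have /= -> := phif x.
  exact: alg_gen_valP.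
have jS x : alg_gen S (j x).
  by have [z _ <-] : range p x by rewrite p_onto.
have [j' j'E] := alg_gen_corestriction jS.
have j'_env : is_enveloping_map j'.
  move=> x y; apply: val_inj; rewrite j'E j_env.
  by rewrite -!j'E.
have [[phi phij] _] := j_univ B j' j'_env.
have [_ uniq] := j_univ U j j_env.
move=> x _; have := alg_gen_valP (phi x).
have -> // : alg_gen_val (phi x) = x.
pose w : U -> U := (\val : alg_gen_type S -> U) \o phi.
pose vphi : {lrmorphism U -> U} :=
  HB.pack w (GRing.Linear.on w) (GRing.RMorphism.on w).
apply: (uniq vphi idfun) => // y /=.
by rewrite -[RHS]j'E; congr \val; apply: phij.
Qed.

(** * The height grading and the derived Cartan subalgebra *)

Section WordLevels.
Variables (F : fieldType) (l : nat) (H : lmodType F) (L : lieAlgType F).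
Variables (h : {linear H -> L}) (e f : 'I_l -> L).
Hypotheses (wt : forall x i, exists c : F, bracket (h x) (e i) = c *: e i)
  (fe : forall k i, range h (bracket (f k) (e i))).

(* Span of the right-normed brackets of [n + 1] elements among the [e i]. *)
Fixpoint word_level n : set L :=
  if n is m.+1 then
    lin_span [set bracket (e i) w | i in [set: 'I_l] & w in word_level m]
  else lin_span (range e).

Lemma word_level_subspace n : is_subspace (word_level n).
Proof. by case: n => [|n]; apply: lin_span_subspace. Qed.

Lemma word_level_e i n w : word_level n w -> word_level n.+1 (bracket (e i) w).
Proof. by move=> Ww; apply: lin_span_in; exists i => //; exists w. Qed.

Lemma word_level_h x n w : word_level n w -> word_level n (bracket (h x) w).
Proof.
elim: n w => [|n IHn]; apply: lin_span_sub.
- exact/bracketl_preim_subspace/word_level_subspace.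
- move=> _ [i _ <-]; have [c] := wt x i; rewrite /= => ->.
  by apply: (subspaceZ _ (word_level_subspace 0)); apply: lin_span_in; exists i.
- exact/bracketl_preim_subspace/word_level_subspace.
move=> _ [i _ [w Ww <-]] /=; have [c he] := wt x i.
rewrite bracket_bracket he; apply: (subspaceD (word_level_subspace n.+1)).
  have := bracketPl c (e i) 0 w; rewrite !addr0 bracket0l addr0 => ->.
  by apply: (subspaceZ _ (word_level_subspace n.+1)); apply: word_level_e.
by apply: word_level_e; apply: IHn.
Qed.

Lemma word_level_f0 k w : word_level 0 w -> range h (bracket (f k) w).
Proof.
have sh : is_subspace (range h).
  by apply: image_subspace; split.
move: w; apply: lin_span_sub; first exact: bracketl_preim_subspace.
by move=> _ [i _ <-]; apply: fe.
Qed.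

(** By Jacobi, [ad (f k)] acts on one letter at a time and turns it into a Cartan element, which
    preserves levels. The section hypotheses are also available with [e] and [f] exchanged, and both
    versions are used below. *)
Lemma word_level_f k n w : word_level n.+1 w -> word_level n (bracket (f k) w).
Proof.
elim: n w => [|n IHn]; apply: lin_span_sub.
- exact/bracketl_preim_subspace/word_level_subspace.
- move=> _ [i _ [w Ww <-]] /=; rewrite bracket_bracket.
  have [[x _ <-] [y _ <-]] := (fe k i, word_level_f0 k Ww).
  apply: (subspaceD (word_level_subspace 0)); first exact: word_level_h.
  rewrite bracketC; apply: (subspaceN (word_level_subspace 0)).
  by apply: word_level_h; apply: lin_span_in; exists i.
- exact/bracketl_preim_subspace/word_level_subspace.
move=> _ [i _ [w Ww <-]] /=; rewrite bracket_bracket.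
have [x _ <-] := fe k i.
apply: (subspaceD (word_level_subspace n.+1)); first exact: word_level_h.
by apply: word_level_e; apply: IHn.
Qed.

Lemma word_level_morph0 (M : lieAlgType F) (phi : {linear L -> M}) n w :
  is_lie_morphism phi -> (forall i, phi (e i) = 0) -> word_level n w -> phi w = 0.
Proof.
move=> phiP phie; have sK := ker_subspace phi.
move: w; case: n => [|n]; apply: lin_span_sub => // x [i _].
  by move=> <-; apply: phie.
by case=> w _ <- /=; rewrite phiP phie bracket0l.
Qed.

End WordLevels.

Section Height.
Variables (F : fieldType) (l : nat) (H : vectType F).
Variables (hc : 'I_l -> H) (alpha : 'I_l -> 'Hom(H, F^o)).
Variables (L : lieAlgType F) (h : {linear H -> L}) (e f : 'I_l -> L).
Hypothesis rel : chevalley_relations hc alpha h e f.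

Let hh x y : bracket (h x) (h y) = 0. Proof. by case: rel. Qed.

Let wte x i : exists c : F, bracket (h x) (e i) = c *: e i.
Proof. by case: rel => _ he _ _; exists (alpha i x). Qed.

Let wtf x i : exists c : F, bracket (h x) (f i) = c *: f i.
Proof. by case: rel => _ _ hf _; exists (- alpha i x). Qed.

Let ef i k : range h (bracket (e i) (f k)).
Proof.
case: rel => _ _ _ ->; case: eqP => _; first by exists (hc i).
by exists 0; rewrite ?linear0.
Qed.

Let fe k i : range h (bracket (f k) (e i)).
Proof.
have [x _ hx] := ef i k.
by exists (- x); rewrite // linearN hx bracketC opprK.
Qed.

(** [word_level _ m] uses [m + 1] letters and [Negz m] is [-(m + 1)], so the indices match on both
    sides. *)
Definition height_part (n : int) : set L :=
  match n with
  | Posz 0 => range h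
  | Posz m.+1 => word_level e m
  | Negz m => word_level f m
  end.

Lemma height_part_subspace n : is_subspace (height_part n).
Proof.
by case: n => [[|m]|m]; [apply: image_subspace|apply: word_level_subspace..].
Qed.

Lemma height_part_h n x y : height_part n y -> height_part n (bracket (h x) y).
Proof.
case: n => [[|m]|m] /=; last exact: word_level_h.
  by case=> z _ <-; rewrite hh; exists 0; rewrite ?linear0.
exact: word_level_h.
Qed.

Lemma height_part_e n i y :
  height_part n y -> height_part (n + 1) (bracket (e i) y).
Proof.
case: n => [m|[|m]].
- rewrite -PoszD addn1; case: m => [|m] /=; last exact: word_level_e.
  case=> x _ <-; rewrite bracketC; apply: (subspaceN (lin_span_subspace _)).
  have [c ->] := wte x i; apply: (subspaceZ _ (lin_span_subspace _)).
  by apply: lin_span_in; exists i.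
- by rewrite NegzE addNr; apply: word_level_f0.
have -> : Negz m.+1 + 1 = Negz m by rewrite !NegzE -[m.+2]addn1 PoszD opprD addrNK.
exact: (word_level_f wtf ef).
Qed.

Lemma height_part_f n i y :
  height_part n y -> height_part (n - 1) (bracket (f i) y).
Proof.
case: n => [[|[|m]]|m].
- case=> x _ <-; rewrite bracketC; apply: (subspaceN (lin_span_subspace _)).
  have [c ->] := wtf x i; apply: (subspaceZ _ (lin_span_subspace _)).
  by apply: lin_span_in; exists i.
- by rewrite subrr; apply: word_level_f0.
- have -> : Posz m.+2 - 1 = Posz m.+1 by rewrite -[m.+2]addn1 PoszD addrK.
  exact: (word_level_f wte fe).
have -> : Negz m - 1 = Negz m.+1 by rewrite !NegzE -opprD -PoszD addn1.
exact: word_level_e.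
Qed.

(** Coarsening of the grading along which each [e i] has degree 1; elements of height zero still lie
    in [range h]. *)
Definition height (d : 'rV[int]_l) : int := \sum_i d 0 i.

Lemma heightD d d' : height (d + d') = height d + height d'.
Proof. by rewrite -big_split; apply: eq_bigr => i _; rewrite mxE. Qed.

Lemma heightN d : height (- d) = - height d.
Proof. by rewrite -sumrN; apply: eq_bigr => i _; rewrite mxE. Qed.

Lemma height0 : height 0 = 0.
Proof. by apply: big1 => i _; rewrite mxE. Qed.

Lemma height_delta i : height (delta_mx 0 i) = 1.
Proof.
rewrite /height (bigD1 i) //= big1 ?addr0 => [|k /negPf ki];
  rewrite mxE ?ki ?andbF //.
by rewrite !eqxx.
Qed.

(** Induction on the construction of [x]: generators are treated above, and Jacobi expresses [ad] of
    a bracket as a commutator of two [ad] maps. *)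
Lemma height_part_bracket d x n y : homogeneous h e f d x ->
  height_part n y -> height_part (n + height d) (bracket x y).
Proof.
move=> dx; elim: dx n y => {d x}
  [x|i|i|d|d a x y _ IHx _ IHy|d d' x y _ IHx _ IHy] n z nz.
- by rewrite height0 addr0; apply: height_part_h.
- by rewrite height_delta; apply: height_part_e.
- by rewrite heightN height_delta; apply: height_part_f.
- by rewrite bracket0l; apply: subspace0 (height_part_subspace _).
- by rewrite bracketPl; apply: (height_part_subspace _).2; [apply: IHx|apply: IHy].
have -> : bracket (bracket x y) z
    = bracket x (bracket y z) - bracket y (bracket x z).
  by rewrite (bracket_bracket x) addrK.
apply: (subspaceB (height_part_subspace _)); rewrite heightD.
  by rewrite [height d + _]addrC addrA; apply/IHx/IHy.
by rewrite addrA; apply/IHy/IHx.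
Qed.

Lemma homogeneous_height d x : homogeneous h e f d x -> height_part (height d) x.
Proof.
elim=> {d x} [x|i|i|d|d a x y _ IHx _ IHy|d d' x y dx IHx dy IHy].
- by rewrite height0; exists x.
- by rewrite height_delta; apply: lin_span_in; exists i.
- by rewrite heightN height_delta; apply: lin_span_in; exists i.
- exact: subspace0 (height_part_subspace _).
- exact: (height_part_subspace _).2.
by rewrite heightD addrC; apply: height_part_bracket.
Qed.

(* The degree-zero part of the graded ideal lies in [range h], hence vanishes;
   everything else is a sum of brackets of the [e i] or of the [f i]. *)
Lemma graded_ideal_morph0 (N : set L) (M : lieAlgType F) (phi : {linear L -> M}) :
  is_graded_ideal h e f N -> N `&` range h = [set 0] ->
  is_lie_morphism phi -> (forall i, phi (e i) = 0) -> (forall i, phi (f i) = 0) ->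
  N `<=` [set x | phi x = 0].
Proof.
move=> [_ Nspan] Nh phiP phie phif x /Nspan; move: x; apply: lin_span_sub.
  exact: ker_subspace.
move=> x [Nx [d /homogeneous_height]]; case: (height d) => [[|m]|m] hx.
- have : (N `&` range h) x by split.
  by rewrite Nh => -> /=; rewrite linear0.
- exact: word_level_morph0 phiP phie hx.
exact: word_level_morph0 phiP phif hx.
Qed.

End Height.

Lemma cartan_derived (F : fieldType) (l : nat) (H : vectType F)
    (hc : 'I_l -> H) (alpha : 'I_l -> 'Hom(H, F^o)) (g : lieAlgType F)
    (h : {linear H -> g}) (e f : 'I_l -> g) :
  is_borcherds_algebra hc alpha h e f ->
  range h `&` @derived F g `<=` lin_span (range (h \o hc)).
Proof.
case=> gt [ht [et [ft [p [[relt pres] [p_morph p_onto] [[Ngr Nh] _] [ph pe pf]]]]]].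
move=> _ [[x _ <-] hx_der].
pose V := <<[seq hc i | i : 'I_l]>>%VS.
(* The quotient of [H] by the span of the coroots, realized inside [H] as a projection with kernel
   [V]. *)
pose q : {linear H -> abelian_lie H} := (\1 - projv V)%VF.
have qE (y : H) : q y = y - projv V y :> H.
  by rewrite /q /= add_lfunE opp_lfunE id_lfunE.
have q_hc i : q (hc i) = 0.
  have hcV : hc i \in V by rewrite memv_span // map_f // mem_enum.
  by rewrite qE projv_id // subrr.
have relq : chevalley_relations hc alpha (L := abelian_lie H) q (fun=> 0) (fun=> 0).
  split=> [//|x' i|x' i|i k]; rewrite ?scaler0 //.
  by case: eqP; rewrite ?q_hc.
have [[phi [phiP phih phie phif]] _] := pres _ q _ _ relq.
have phiN := graded_ideal_morph0 relt Ngr Nh phiP phie phif.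
(* A derived element lifts to a combination of brackets in [gt], which [phi] kills since its target
   is abelian. *)
have [d d_der pd] : exists2 d, phi d = 0 & p d = h x.
  move: (h x) hx_der; apply: lin_span_sub.
    by apply: (image_subspace p); apply: ker_subspace.
  move=> _ [y _ [z _ <-]].
  have [[y' _ <-] [z' _ <-]] : range p y /\ range p z by rewrite p_onto.
  by exists (bracket y' z'); rewrite ?p_morph ?phiP.
have qx : q x = 0.
  (* [ht x - d] lies in the kernel of [p], the graded ideal, so [phi] kills it as well. *)
  rewrite -phih /= -[ht x](subrK d) linearD d_der addr0; apply: phiN.
  by rewrite /= linearB pd -ph subrr.
have {qx} xV : x \in V.
  have -> : x = projv V x.
    by apply/eqP; rewrite -subr_eq0 -qE qx.
  by rewrite memv_proj.
rewrite (coord_span xV) linear_sum; elim/big_ind: _ => [|y z Sy Sz|i _].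
- exact: subspace0 (lin_span_subspace _).
- exact: (subspaceD (lin_span_subspace _)).
have : [seq hc k | k : 'I_l]`_i \in [seq hc k | k : 'I_l].
  by apply: mem_nth; rewrite size_image ltn_ord.
case/mapP=> k _ ->; rewrite linearZ.
apply: (subspaceZ _ (lin_span_subspace _)).
by apply: lin_span_in; exists k.
Qed.

(** * Assembly of the factorization *)

Lemma enveloping_triangular_relations (F : fieldType) (l : nat) (H : vectType F)
    (hc : 'I_l -> H) (alpha : 'I_l -> 'Hom(H, F^o)) (g : lieAlgType F)
    (h : {linear H -> g}) (e f : 'I_l -> g) (U : algType F)
    (j : {linear g -> U}) :
  chevalley_relations hc alpha h e f -> is_enveloping_map j ->
  triangular_relations (j \o e) (j \o f) (fun i => j (h (hc i)))
    (range (j \o h)).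
Proof.
move=> [hh he hf ef] j_env.
have wt x y (c : F) : bracket x y = c *: y ->
    exists c' : F, j y * j x = (j x + c'%:A) * j y.
  move=> xy; exists (- c); have := j_env x y; rewrite xy linearZ => cy.
  by rewrite mulrDl -scalerAl mul1r scaleNr cy opprB addrCA subrr addr0.
split=> [_ _ [x _ <-] [y _ <-]|_ i [x _ <-]|_ i [x _ <-]|i k|i].
- by apply/eqP; rewrite -subr_eq0 -j_env hh linear0.
- exact: wt (he x i).
- exact: wt (hf x i).
- apply/eqP; rewrite addrC -subr_eq /= -j_env ef.
  by case: (i =P k); rewrite ?linear0.
by exists (hc i).
Qed.

Theorem proposition3p1 (F : fieldType) (charF0 : [pchar F] =i pred0)
  (R : realType) (K : fieldType)
  (KR : {rmorphism K -> R}) (KF : {rmorphism K -> F})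
  (l : nat) (l_gt0 : (0 < l)%N) (A : 'M[K]_l)
  (A_borcherds : is_borcherds_matrix (map_mx KR A))
  (H : vectType F) (hc : 'I_l -> H) (alpha : 'I_l -> 'Hom(H, F^o))
  (hc_free : free [seq hc i | i : 'I_l])
  (alpha_neq0 : forall i, alpha i != 0)
  (alpha_hc : forall i k, alpha k (hc i) = KF (A i k))
  (g : lieAlgType F) (h : {linear H -> g}) (e f : 'I_l -> g)
  (g_borcherds : is_borcherds_algebra hc alpha h e f)
  (U : algType F) (j : {linear g -> U})
  (U_enveloping : is_enveloping_algebra j)
  (h2 : set g)
  (h2_compl : is_complement h2 (range h `&` @derived F g) (range h))
  (I J : {set 'I_l})
  (IJ_cover : (I :|: J = [set: 'I_l])%SET)
  (IJ_disj : (I :&: J = finset.set0)%SET) :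
  let UU := env_sub j in
  let g_plus := lie_gen (range e) in
  let g_minus := lie_gen (range f) in
  let P := \big[@set_mul F U/@set_one F U]_(i < l | i \in I)
             UU (lin_span [set e i]) in
  let Q := \big[@set_mul F U/@set_one F U]_(i < l | i \in J)
             UU (lin_span [set f i]) in
  [set: U] =
    set_mul (set_mul (set_mul (set_mul P (UU g_minus)) (UU h2)) (UU g_plus)) Q.

Proof.
move=> UU g_plus g_minus P Q; apply/seteqP; split=> // x _.
set E := j \o e; set G := j \o f; pose hs i := j (h (hc i)).
have rel : triangular_relations E G hs (range (j \o h)).
  apply: enveloping_triangular_relations U_enveloping.1.
  exact: borcherds_chevalley g_borcherds.
have [h2_sub h2_h _ h_sum] := h2_compl.
have TS : j @` h2 `<=` range (j \o h).
  by move=> _ [y /h2_h [z _ <-] <-]; exists z.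
(* A Cartan element is a sum of a part in [h2] and a derived part, and the latter is a combination
   of coroots. *)
have T_all : range (j \o h) `<=` alg_gen (j @` h2 `|` range hs).
  set C := alg_gen _; have sC : is_subspace C by apply: alg_gen_subspace.
  move=> _ [y _ <-] /=.
  have : range h (h y) by exists y.
  rewrite {1}h_sum => -[y1 h2y1 [y2 /(cartan_derived g_borcherds) y2P <-]].
  rewrite linearD; apply: (subspaceD sC).
    by apply: alg_gen_in; left; exists y1.
  move: y2 y2P; apply: lin_span_sub; first exact: preimage_subspace.
  by move=> _ [i _ <-]; apply: alg_gen_in; right; exists i.
have gen_e i : alg_gen [set E i] `<=` UU (lin_span [set e i]).
  by apply: alg_genS => _ ->; exists (e i) => //; apply: lin_span_in.
have gen_f i : alg_gen [set G i] `<=` UU (lin_span [set f i]).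
  by apply: alg_genS => _ ->; exists (f i) => //; apply: lin_span_in.
(* Filtering keeps the increasing order, so the products over [rI] and [rJ] are [P] and [Q]. *)
pose rI := [seq i <- index_enum 'I_l | i \in I].
pose rJ := [seq i <- index_enum 'I_l | i \in J].
(* The coroots of [J] stay in the base set while those of [I] are traded on the left; they are
   traded on the right afterwards. *)
pose TJ := j @` h2 `|` [set hs i | i in [set` rJ]].
have TJS : TJ `<=` range (j \o h).
  by move=> y [/TS//|[i _ <-]]; exists (hc i).
have T_sub : alg_gen (range (j \o h)) `<=`
    alg_gen (TJ `|` [set hs i | i in [set` rI]]).
  apply: alg_gen_sub; first exact: alg_gen_subalgebra.
  move=> y /T_all; apply: alg_genS => z [h2z|[i _ <-]]; first by do 2!left.
  have : i \in I :|: J by rewrite IJ_cover inE.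
  rewrite inE => /orP[iI|iJ]; [right|left; right]; exists i => //.
    by rewrite /= mem_filter iI mem_index_enum.
  by rewrite /= mem_filter iJ mem_index_enum.
have span_x : triangular_span E G (TJ `|` [set hs i | i in [set` rI]]) x.
  have gen_x : alg_gen (range (j \o h) `|` range E `|` range G) x.
    exact: (enveloping_generated g_borcherds U_enveloping).
  have := triangular_decomposition rel gen_x.
  by do 2?[apply: set_mulS => //].
have {span_x} := adjoin_coroots_left rel charF0 gen_e TJS span_x.
rewrite big_filter -/P.
suff sub : triangular_span E G TJ `<=`
    set_mul (set_mul (set_mul (UU g_minus) (UU h2)) (UU g_plus)) Q.
  by move=> /(set_mulS (fun y Py => Py) sub); rewrite !set_mulA.
move=> y /(adjoin_coroots_right rel charF0 gen_f TS).
rewrite big_filter -/Q; apply: set_mulS => //.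
(* The subalgebras generated by the images of the [f i] and of the [e i] lie in those of [g_minus]
   and [g_plus]. *)
apply: set_mulS; first apply: set_mulS => //.
  by apply: alg_genS => _ [i _ <-]; exists (f i) => // C [_]; apply; exists i.
by apply: alg_genS => _ [i _ <-]; exists (e i) => // C [_]; apply; exists i.
Qed.
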